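(* Let $R$ be a reduced ring. Then a left ideal of $R$ is nil-essential if and only if it is essential. Consequently, the intersection of all nil-essential left ideals of $R$ is the socle of the left $R$-module ${}_RR$.
   Context: Rings are associative with identity, not necessarily commutative. A ring is reduced if it has no non-zero nilpotent elements. A left ideal $I$ of $R$ is essential if, for every left ideal $\mu$ of $R$, $I\cap\mu=0$ implies $\mu=0$. A left ideal $I$ of $R$ is nil-essential if, for every left ideal $\mu$ of $R$, $I\cap\mu=0$ implies that $\mu$ is nilpotent, i.e. $\mu^n=0$ for some $n\geq 1$. *)

(* Defs.v *)
From mathcomp Require Import all_boot all_algebra.
From mathcomp Require Import boolp classical_sets.

Set Implicit Arguments.
Unset Strict Implicit.
Unset Printing Implicit Defensive.

Import GRing.Theory.

Local Open Scope classical_set_scope.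
Local Open Scope ring_scope.

(* Rings are [pzRingType]s: associative, unital, not necessarily commutative,
   with the zero ring allowed. *)
Definition reduced_ring (R : pzRingType) : Prop :=
  forall (x : R) (n : nat), x ^+ n = 0 -> x = 0.

Section Modules.
Variables (R : pzRingType) (V : lmodType R).

(* [in N] turns the set N into a boolean predicate (by excluded middle), the
   form expected by [GRing.submod_closed]. *)
Definition submodule (N : set V) : Prop := GRing.submod_closed [in N].

Definition simple_submodule (N : set V) : Prop :=
  [/\ submodule N, N <> [set 0] &
      forall L : set V, submodule L -> L `<=` N -> L = [set 0] \/ L = N].

(* The sum of all simple submodules, i.e. the set of finite sums of elements
   each of which lies in some simple submodule. *)
Definition socle : set V :=
  [set v | exists s : seq V,
     (forall x, x \in s -> exists2 N, simple_submodule N & N x) /\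
     v = \sum_(x <- s) x].

End Modules.

Arguments socle {R} V.

Section LeftIdeals.
Variable R : pzRingType.

(* [R^o] is R as a left module over itself. *)
Definition left_ideal (I : set R) : Prop := submodule (I : set R^o).

(* The additive subgroup generated by the products x * y, x in I, y in J. *)
Definition ideal_mul (I J : set R) : set R :=
  [set z | exists s : seq (R * R),
     (forall p, p \in s -> I p.1 /\ J p.2) /\ z = \sum_(p <- s) p.1 * p.2].

(* [ideal_exp I 1] is I itself; it must not be computed as the product of I
   with R, which can be strictly larger than I when I is only a left ideal. *)
Definition ideal_exp (I : set R) (n : nat) : set R :=
  iterop n ideal_mul I setT.

Definition nilpotent_ideal (I : set R) : Prop :=
  exists2 n : nat, (1 <= n)%N & ideal_exp I n = [set 0].

Definition essential (I : set R) : Prop :=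
  forall mu : set R, left_ideal mu -> I `&` mu = [set 0] -> mu = [set 0].

Definition nil_essential (I : set R) : Prop :=
  forall mu : set R, left_ideal mu -> I `&` mu = [set 0] -> nilpotent_ideal mu.

End LeftIdeals.

(* Main.v *)
Require Import Defs.
From mathcomp Require Import all_boot all_algebra.
From mathcomp Require Import boolp classical_sets.

Import GRing.Theory.

Local Open Scope classical_set_scope.
Local Open Scope ring_scope.

(** In a reduced ring a nilpotent left ideal mu is zero: if x lies in mu, then
    x ^+ n lies in the n-th power of mu, which vanishes for some n >= 1, so x is
    nilpotent and hence zero. The two notions of essentiality therefore agree,
    and it remains to see that the socle of a module V is the intersection of
    its essential submodules, which holds over any ring.

    A simple submodule S meets an essential submodule E in 0 or in S; the first
    case would force S = 0, so S lies in E ([simple_sub_essential]).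

    Conversely, suppose that x lies in every essential submodule but not in the
    socle. Choose M maximal among the submodules that contain the socle and
    avoid x, then C maximal among the submodules that meet M trivially. The sum
    M + C is essential ([essential_add_complement]), so x = m + c with m in M
    and c in C, and c <> 0. If L is a nonzero submodule of C, then M + L contains
    M strictly, hence contains x; as M and C are independent, the C-component c
    of x lies in L. So the cyclic submodule of c is simple. It is then contained
    in the socle, hence in M, although c is a nonzero element of C: a
    contradiction ([essential_sub_socle]). *)

(** * Submodules *)

Section Submodules.
Context {R : pzRingType} {V : lmodType R}.
Implicit Types (N M C L E A X : set V) (x : V).

Definition add_submodule M C : set V := [set m + c | m in M & c in C].

Definition cyclic_submodule x : set V := [set a *: x | a in [set: R]].

Definition essential_submodule E : Prop :=
  forall L, submodule L -> E `&` L = [set 0] -> L = [set 0].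

Lemma submoduleP N :
  submodule N <-> N 0 /\ forall a u v, N u -> N v -> N (a *: u + v).
Proof.
rewrite /submodule; split=> -[N0 Nlin]; split.
- by have := N0; rewrite !inE.
- move=> a u v Nu Nv.
  by have := Nlin a u v; rewrite !inE; apply.
- by rewrite !inE.
- by move=> a u v; rewrite !inE; exact: Nlin.
Qed.

Lemma submodule0 N : submodule N -> N 0.
Proof. by case/submoduleP. Qed.

Lemma submoduleZ N a x : submodule N -> N x -> N (a *: x).
Proof. by case/submoduleP=> N0 Nlin Nx; rewrite -[a *: x]addr0; exact: Nlin. Qed.

Lemma submoduleD N x y : submodule N -> N x -> N y -> N (x + y).
Proof. by case/submoduleP=> N0 Nlin Nx Ny; rewrite -[x]scale1r; exact: Nlin. Qed.

Lemma submoduleB N x y : submodule N -> N x -> N y -> N (x - y).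
Proof.
move=> Nsub Nx Ny; apply: submoduleD => //.
by rewrite -scaleN1r; exact: submoduleZ.
Qed.

Lemma submodule_sum N (s : seq V) :
  submodule N -> (forall x, x \in s -> N x) -> N (\sum_(x <- s) x).
Proof.
move=> Nsub Ns; rewrite big_seq; apply: big_ind => //.
- exact: submodule0.
- by move=> x y; exact: submoduleD.
Qed.

Lemma submodule_set0 : submodule [set 0 : V].
Proof.
by apply/submoduleP; split=> //= a u v -> ->; rewrite scaler0 addr0.
Qed.

Lemma submoduleI M C : submodule M -> submodule C -> submodule (M `&` C).
Proof.
case/submoduleP=> M0 Mlin /submoduleP[C0 Clin]; apply/submoduleP; split=> //.
by move=> a u v [Mu Cu] [Mv Cv]; split; [exact: Mlin | exact: Clin].
Qed.

Lemma submodule_add M C :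
  submodule M -> submodule C -> submodule (add_submodule M C).
Proof.
case/submoduleP=> M0 Mlin /submoduleP[C0 Clin]; apply/submoduleP; split.
  by exists 0 => //; exists 0 => //; rewrite addr0.
move=> a _ _ [m Mm [c Cc <-]] [m' Mm' [c' Cc' <-]].
exists (a *: m + m'); first exact: Mlin.
exists (a *: c + c'); first exact: Clin.
by rewrite scalerDr addrACA.
Qed.

Lemma sub_addl M C : submodule C -> M `<=` add_submodule M C.
Proof.
by move=> Csub m Mm; exists m => //; exists 0;
  [exact: submodule0 | rewrite addr0].
Qed.

Lemma sub_addr M C : submodule M -> C `<=` add_submodule M C.
Proof.
by move=> Msub c Cc; exists 0; [exact: submodule0 | exists c => //; rewrite add0r].
Qed.

Lemma submodule_cyclic x : submodule (cyclic_submodule x).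
Proof.
apply/submoduleP; split; first by exists 0 => //; rewrite scale0r.
move=> a _ _ [b _ <-] [b' _ <-].
by exists (a * b + b') => //; rewrite scalerDl scalerA.
Qed.

Lemma cyclic_mem x : cyclic_submodule x x.
Proof. by exists 1 => //; rewrite scale1r. Qed.

Lemma submodule_eq0 N : submodule N -> (forall x, N x -> x = 0) -> N = [set 0].
Proof.
by move=> Nsub N0; apply/seteqP; split=> [x /N0 //|_ ->]; exact: submodule0.
Qed.

Lemma submodule_neq0 N :
  submodule N -> N <> [set 0] -> exists2 x, N x & x <> 0.
Proof.
move=> Nsub Nn0; apply: contrapT => noel; apply: Nn0.
apply: submodule_eq0 => // x Nx; apply: contrapT => x0.
by apply: noel; exists x.
Qed.

(** An application of Zorn's lemma used for two choices of X: a point, which M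
    is to avoid, and the nonzero elements of a submodule, which M is to meet
    trivially. *)
Lemma maximal_submodule_avoiding A X :
    submodule A -> A `&` X = set0 ->
  exists M, [/\ submodule M, A `<=` M, M `&` X = set0 &
    forall N, submodule N -> M `<=` N -> N `&` X = set0 -> N `<=` M].
Proof.
move=> Asub AX.
(* Testing A `|` N instead of N lets the empty chain have its union, the empty
   set, as an upper bound. *)
pose P := [set N | submodule (A `|` N) /\ (A `|` N) `&` X = set0].
have [F FP Ftot|N [[ANsub ANX] Nmax]] := @Zorn_bigcup V P.
  split.
  - apply/submoduleP; split; first by left; exact: submodule0.
    move=> a u v [Au|[N FN Nu]] [Av|[N' FN' Nv]].
    + by left; apply: submoduleD => //; exact: submoduleZ.
    + have [sub _] := FP _ FN'.
      have [|Nw|Nw] := @submoduleD _ (a *: u) v sub _ (or_intror Nv).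
      * by apply: submoduleZ => //; left.
      * by left.
      * by right; exists N'.
    + have [sub _] := FP _ FN.
      have [|Nw|Nw] := @submoduleD _ (a *: u) v sub _ (or_introl Av).
      * by apply: submoduleZ => //; right.
      * by left.
      * by right; exists N.
    + have [K FK [Ku Kv]] : exists2 K, F K & K u /\ K v.
        by have [le|le] := Ftot _ _ FN FN'; [exists N' | exists N] => //;
          split=> //; exact: le.
      have [sub _] := FP _ FK.
      have [|Kw|Kw] := @submoduleD _ (a *: u) v sub _ (or_intror Kv).
      * by apply: submoduleZ => //; right.
      * by left.
      * by right; exists K.
  - rewrite -subset0 => x [[Ax|[N FN Nx]] Xx]; first by rewrite -AX; split.
    by have [_ <-] := FP _ FN; split=> //; right.
exists (A `|` N); split=> //.
move=> B Bsub AN_B BX.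
have AB : A `|` B = B.
  by apply/seteqP; split=> x; [case=> // Ax; apply: AN_B; left | right].
have NB : N `<=` B by move=> x Nx; apply: AN_B; right.
move=> x Bx; right; apply: contrapT => Nx.
apply: (Nmax B); last by rewrite /P /= AB.
by split=> // BN; apply: Nx; exact: BN.
Qed.

(** * Complements and essential submodules *)

(** If L meets M + C trivially, then C + L still meets M trivially, so
    maximality of C puts L inside C. *)
Lemma essential_add_complement M C :
    submodule M -> submodule C -> (forall x, M x -> C x -> x = 0) ->
    (forall N, submodule N -> C `<=` N ->
      (forall x, M x -> N x -> x = 0) -> N `<=` C) ->
  essential_submodule (add_submodule M C).
Proof.
move=> Msub Csub MC Cmax L Lsub MCL.
have CLC : add_submodule C L `<=` C.
  apply: Cmax; [exact: submodule_add | exact: sub_addl |].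
  move=> x Mx [c Cc [l Ll E]].
  have l0 : l = 0.
    have : (add_submodule M C `&` L) l.
      split=> //; exists x => //; exists (0 - c).
        by apply: submoduleB => //; exact: submodule0.
      by rewrite -E sub0r addrAC subrr add0r.
    by rewrite MCL.
  by apply: MC => //; rewrite -E l0 addr0.
apply: submodule_eq0 => // x Lx.
have : (add_submodule M C `&` L) x.
  by split=> //; apply: sub_addr => //; apply: CLC; exact: sub_addr.
by rewrite MCL.
Qed.

Lemma exists_complement M :
    submodule M ->
  exists C, [/\ submodule C, (forall x, M x -> C x -> x = 0) &
    essential_submodule (add_submodule M C)].
Proof.
move=> Msub; pose X := [set x | M x /\ x <> 0].
have avoidX N : N `&` X = set0 <-> forall x, M x -> N x -> x = 0.
  split=> [NX x Mx Nx|MN].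
    by apply: contrapT => x0; suff: (N `&` X) x by rewrite NX.
  by rewrite -subset0 => x [Nx [Mx x0]]; apply: x0; exact: MN.
have [|C [Csub _ /avoidX MC Cmax]] :=
  @maximal_submodule_avoiding [set 0] X submodule_set0.
  exact/avoidX.
exists C; split=> //; apply: essential_add_complement => // N Nsub CN MN.
by apply: Cmax => //; exact/avoidX.
Qed.

(** * The socle *)

Lemma submodule_socle : submodule (socle V).
Proof.
apply/submoduleP; split; first by exists [::]; rewrite big_nil.
move=> a _ _ [s [sS ->]] [t [tS ->]].
exists ([seq a *: x | x <- s] ++ t); split; last first.
  by rewrite big_cat big_map scaler_sumr.
move=> x; rewrite mem_cat => /orP[/mapP[y /sS[N Nsimple Ny] ->]|/tS //].
by exists N => //; apply: submoduleZ => //; case: Nsimple.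
Qed.

Lemma simple_sub_socle N : simple_submodule N -> N `<=` socle V.
Proof.
move=> Nsimple x Nx; exists [:: x]; split; last by rewrite big_seq1.
by move=> y; rewrite mem_seq1 => /eqP ->; exists N.
Qed.

Lemma simple_sub_essential N E :
  submodule E -> essential_submodule E -> simple_submodule N -> N `<=` E.
Proof.
move=> Esub Eess [Nsub N0 Nmin].
have [|EN|EN] := Nmin (E `&` N) (submoduleI _ _ Esub Nsub).
- by move=> x [].
- by case: N0; exact: Eess.
- by rewrite -EN => x [].
Qed.

Lemma socle_sub_essential E :
  submodule E -> essential_submodule E -> socle V `<=` E.
Proof.
move=> Esub Eess _ [s [sS ->]]; apply: submodule_sum => // x /sS[N Nsimple].
exact: (simple_sub_essential _ _ Esub Eess Nsimple).
Qed.

Lemma cyclic_simple c :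
    c <> 0 ->
    (forall L, submodule L -> L `<=` cyclic_submodule c -> L <> [set 0] ->
      L c) ->
  simple_submodule (cyclic_submodule c).
Proof.
move=> c0 Lc; split; first exact: submodule_cyclic.
  by move=> E; apply: c0; have := cyclic_mem c; rewrite E.
move=> L Lsub LRc; have [|L0] := pselect (L = [set 0]); [by left | right].
apply/seteqP; split=> // _ [a _ <-].
by apply: submoduleZ => //; exact: Lc.
Qed.

Lemma essential_sub_socle x :
    (forall E, submodule E -> essential_submodule E -> E x) ->
  socle V x.
Proof.
move=> xE; apply: contrapT => xS.
have [|M [Msub socM Mx Mmax]] :=
  @maximal_submodule_avoiding (socle V) [set x] submodule_socle.
  by rewrite -subset0 => y [Sy yx]; apply: xS; rewrite -yx.
have {}Mx : ~ M x.
  by move=> xM; suff: (M `&` [set x]) x by rewrite Mx.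
have [C [Csub MC MCess]] := exists_complement _ Msub.
have [m Mm [c Cc Dx]] := xE _ (submodule_add _ _ Msub Csub) MCess.
have c0 : c <> 0 by move=> c0; apply: Mx; rewrite -Dx c0 addr0.
suff Mc : M c by apply: c0; exact: MC.
apply: socM.
apply: (simple_sub_socle (cyclic_submodule c)); last exact: cyclic_mem.
apply: cyclic_simple => // L Lsub LRc L0.
have LC : L `<=` C by move=> y /LRc[a _ <-]; exact: submoduleZ.
have [l Ll l0] := submodule_neq0 _ Lsub L0.
(* M + L is strictly larger than M, so it can no longer avoid x. *)
have [m' Mm' [l' Ll' Dx']] : add_submodule M L x.
  apply: contrapT => MLx; apply: l0; apply: MC; last exact: LC.
  apply: (Mmax (add_submodule M L)); [exact: submodule_add | exact: sub_addl | |].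
    by rewrite -subset0 => y [MLy yx]; apply: MLx; rewrite -yx.
  exact: sub_addr.
suff -> : c = l' by [].
apply/eqP; rewrite -subr_eq0; apply/eqP; apply: MC; last first.
  by apply: submoduleB => //; exact: LC.
have -> : c - l' = m' - m.
  apply/eqP; rewrite subr_eq addrAC eq_sym subr_eq.
  by rewrite Dx' [c + m]addrC Dx.
exact: submoduleB.
Qed.

Lemma bigcap_essential_socle :
  \bigcap_(E in [set E | submodule E /\ essential_submodule E]) E = socle V.
Proof.
apply/seteqP; split=> x.
  by move=> xE; apply: essential_sub_socle => E Esub Eess; apply: xE.
by move=> Sx E [Esub Eess]; exact: socle_sub_essential Sx.
Qed.

End Submodules.

(** * Nilpotent left ideals *)

Section ReducedRings.
Variable R : pzRingType.
Implicit Types (I mu : set R).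

Lemma ideal_exp_expr I (x : R) n : I x -> ideal_exp I n (x ^+ n).
Proof.
move=> Ix; case: n => [//|n]; elim: n => [//|n IHn].
exists [:: (x, x ^+ n.+1)]; split; last by rewrite big_seq1 exprS.
by move=> p; rewrite mem_seq1 => /eqP ->.
Qed.

Lemma nilpotent_ideal0 : nilpotent_ideal [set 0 : R].
Proof. by exists 1%N. Qed.

Lemma reduced_nilpotent_ideal mu :
  reduced_ring R -> left_ideal mu -> nilpotent_ideal mu -> mu = [set 0].
Proof.
move=> hR mu_ideal [n _ mun]; apply: (@submodule_eq0 R R^o) => // x mux.
by apply: (hR x n); have := ideal_exp_expr _ _ n mux; rewrite mun.
Qed.

Lemma reduced_nil_essential I :
  reduced_ring R -> nil_essential I <-> essential I.
Proof.
move=> hR; split=> Iess mu mu_ideal Imu.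
  by apply: reduced_nilpotent_ideal => //; exact: Iess.
by rewrite (Iess mu) //; exact: nilpotent_ideal0.
Qed.

End ReducedRings.

Theorem mainTheorem1 (R : pzRingType) (hR : reduced_ring R) :
  (forall I : set R, left_ideal I -> (nil_essential I <-> essential I)) /\
  \bigcap_(I in [set I : set R | left_ideal I /\ nil_essential I]) I =
    socle R^o.
Proof.
split=> [I _|]; first exact: reduced_nil_essential.
rewrite -bigcap_essential_socle; congr (\bigcap_(I in _) I).
apply/seteqP; split=> I [Iideal Iess]; split=> //.
  exact/reduced_nil_essential.
exact/reduced_nil_essential.
Qed.
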